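(* Let $G$ and $H$ be (vertex-disjoint) graphs and let $k\in\{2,3,\ldots,n(G\vee H)-1\}$. Then $${\rm sgp}_k(G\vee H)=\max\{s\omega_k(G\vee H),\ {\rm sjc}_k(G),\ {\rm sjc}_k(H)\}.$$
   Context: All graphs are finite and simple, not necessarily connected; $n(G)$ is the number of vertices. The join $G\vee H$ has vertex set $V(G)\cup V(H)$ and edge set $E(G)\cup E(H)\cup\{gh: g\in V(G),h\in V(H)\}$. For a nonempty $W\subseteq V(G)$, the Steiner distance $d_G(W)$ is the minimum number of edges of a connected subgraph of $G$ containing $W$ ($d_G(W)=\infty$ if none exists); such a minimum subgraph is a tree, a Steiner $W$-tree. A set $A\subseteq V(G)$ is a $k$-Steiner general position set if for every $B\subseteq A$ with $|B|=k$ and every Steiner $B$-tree $T_B$ we have $V(T_B)\cap A=B$; ${\rm sgp}_k(G)$ is the largest cardinality of such a set. A set $A$ is a $k$-Steiner clique if $G[B]$ is connected for every $k$-subset $B\subseteq A$ (sets of size $<k$ qualify trivially); $s\omega_k(G)$ is the largest cardinality of a $k$-Steiner clique. A set $A\subseteq V(G)$ with $|A|\ge k$ is a $k$-Steiner join-critical set if $d_{G[A]}(B)\ne k$ for every $k$-subset $B\subseteq A$ (here $d_{G[A]}$ is Steiner distance in the induced subgraph $G[A]$); ${\rm sjc}_k(G)$ is the largest cardinality of a $k$-Steiner join-critical set of $G$, with the convention that ${\rm sjc}_k(G)=n(G)$ whenever $k\ge n(G)$. *)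

(* Defs.v *)
From mathcomp Require Import all_boot.

Set Implicit Arguments.
Unset Strict Implicit.
Unset Printing Implicit Defensive.

Record sgraph := SGraph {
  vertex :> finType;
  adj : rel vertex;
  adj_sym : symmetric adj;
  adj_irrefl : irreflexive adj
}.

(* The graph with no vertex is not connected. *)
Definition connected (G : sgraph) : bool :=
  (0 < #|G|) && [forall x : G, forall y : G, connect (@adj G) x y].

Section Join.
Variables G H : sgraph.

Definition join_adj (u v : G + H) : bool :=
  match u, v with
  | inl x, inl y => adj x y
  | inr x, inr y => adj x y
  | _, _ => true
  end.

Lemma join_adj_sym : symmetric join_adj.
Proof. by move=> [x|x] [y|y] //=; exact: adj_sym. Qed.

Lemma join_adj_irrefl : irreflexive join_adj.
Proof. by move=> [x|x] /=; exact: adj_irrefl. Qed.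

Definition join : sgraph := SGraph join_adj_sym join_adj_irrefl.

End Join.

Section Subgraphs.
Variable G : sgraph.

Section Induced.
Variable A : {set G}.

Definition induced_adj (u v : {x : G | x \in A}) : bool := adj (val u) (val v).

Lemma induced_adj_sym : symmetric induced_adj.
Proof. by move=> u v; exact: adj_sym. Qed.

Lemma induced_adj_irrefl : irreflexive induced_adj.
Proof. by move=> u; exact: adj_irrefl. Qed.

Definition induced : sgraph := SGraph induced_adj_sym induced_adj_irrefl.

End Induced.

Definition edges : {set {set G}} :=
  [set e | [exists x : G, exists y : G, adj x y && (e == [set x; y])]].

(* An arbitrary (not necessarily induced) subgraph is encoded by a pair
   (vertex set, edge set); the pair is meaningful when [is_subgraph] holds. *)
Definition presubgraph := ({set G} * {set {set G}})%type.

Definition is_subgraph (T : presubgraph) : bool :=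
  (T.2 \subset edges) && [forall e in T.2, e \subset T.1].

Section GraphOf.
Variable T : presubgraph.

(* The test [u != v] only matters for pairs that are not subgraphs. *)
Definition graph_of_adj (u v : {x : G | x \in T.1}) : bool :=
  (u != v) && ([set val u; val v] \in T.2).

Lemma graph_of_adj_sym : symmetric graph_of_adj.
Proof. by move=> u v; rewrite /graph_of_adj eq_sym setUC. Qed.

Lemma graph_of_adj_irrefl : irreflexive graph_of_adj.
Proof. by move=> u; rewrite /graph_of_adj eqxx. Qed.

Definition graph_of : sgraph := SGraph graph_of_adj_sym graph_of_adj_irrefl.

End GraphOf.

Definition connects (W : {set G}) (T : presubgraph) : bool :=
  [&& is_subgraph T, connected (graph_of T) & W \subset T.1].

Definition steiner_tree (W : {set G}) (T : presubgraph) : bool :=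
  connects W T &&
  [forall T' : presubgraph, connects W T' ==> (#|T.2| <= #|T'.2|)].

(* [None] stands for an infinite distance. *)
Definition steiner_dist (W : {set G}) : option nat :=
  if [pick T | steiner_tree W T] is Some T then Some #|T.2| else None.

Lemma steiner_dist_None (W : {set G}) :
  steiner_dist W = None <-> forall T, ~~ connects W T.
Proof.
rewrite /steiner_dist; case: pickP => [T /andP[cT _]|noT]; split=> //.
  by move=> /(_ T); rewrite cT.
move=> _ T; apply/negP=> cT.
case: (@arg_minnP _ T (connects W) (fun T => #|T.2|) cT) => T0 cT0 minT0.
have /negP[] := negbT (noT T0); rewrite /steiner_tree cT0 /=.
by apply/forallP=> T'; apply/implyP; exact: minT0.
Qed.

Lemma steiner_dist_Some (W : {set G}) d :
  steiner_dist W = Some d <->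
  (exists2 T, connects W T & #|T.2| = d) /\
  (forall T, connects W T -> d <= #|T.2|).
Proof.
split.
  rewrite /steiner_dist; case: pickP => // T /andP[cT /forallP minT] [<-].
  by split; [exists T | move=> T' cT'; exact: (implyP (minT T'))].
move=> [[T cT <-] minT]; case E: (steiner_dist W) => [d'|]; last first.
  by have /steiner_dist_None/(_ T) := E; rewrite cT.
move: E; rewrite /steiner_dist; case: pickP => // T' /andP[cT' /forallP minT'].
by case=> <-; congr Some; apply/eqP; rewrite eqn_leq minT // (implyP (minT' T)).
Qed.

End Subgraphs.

Section Invariants.
Variables (k : nat) (G : sgraph).

Definition steiner_general_position (A : {set G}) : bool :=
  [forall B : {set G}, (B \subset A) && (#|B| == k) ==>
    [forall T : presubgraph G, steiner_tree B T ==> (T.1 :&: A == B)]].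

Definition sgp : nat := \max_(A : {set G} | steiner_general_position A) #|A|.

Definition steiner_clique (A : {set G}) : bool :=
  [forall B : {set G}, (B \subset A) && (#|B| == k) ==> connected (induced B)].

Definition somega : nat := \max_(A : {set G} | steiner_clique A) #|A|.

(* The set of x with [val x \in B] is B seen as a vertex set of the induced subgraph on A. *)
Definition steiner_join_critical (A : {set G}) : bool :=
  (k <= #|A|) &&
  [forall B : {set G}, (B \subset A) && (#|B| == k) ==>
    (@steiner_dist (induced A) [set x | val x \in B] != Some k)].

Definition sjc : nat :=
  if #|G| <= k then #|G|
  else \max_(A : {set G} | steiner_join_critical A) #|A|.

End Invariants.

(* Main.v *)
(* A connected subgraph with m edges has at most m + 1 vertices, and every
   connected vertex set carries a spanning tree.  Hence, for a k-set B inducing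
   a disconnected graph, d(B) = k exactly when adding one vertex to B makes it
   connected, and the Steiner B-trees are then the spanning trees of such
   one-point extensions; for B connected they are the spanning trees of G[B].
   In a join every nonempty B has a connected one-point extension, so both
   general position in the join and join-criticality say that no disconnected
   k-subset B of A becomes connected by adding a vertex of A.  A set that
   meets both sides induces a connected graph, so such an A is a Steiner clique
   unless it lies on one side, where it is join-critical. *)
Require Import Defs.
From mathcomp Require Import all_boot.

Set Implicit Arguments.
Unset Strict Implicit.
Unset Printing Implicit Defensive.

(** * Connectivity expressed by edges across cuts *)

Definition cut_connected (T : finType) (e : rel T) (V : {set T}) : Prop :=
  V != set0 /\ forall X : {set T}, X \proper V -> X != set0 ->
    exists u v, [/\ u \in X, v \in V :\: X & e u v].

(** Moves connectivity from a graph on a sigma type to cuts in the ambient type; the map [f] lets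
    one proof serve both [induced] and [graph_of]. A cut that no edge crosses pulls back to a set
    closed under adjacency. *)
Lemma connected_cut (K : sgraph) (T : finType) (f : K -> T) (e : rel T) :
  injective f -> (forall x y, adj x y = e (f x) (f y)) ->
  connected K <-> cut_connected e [set f x | x : K].
Proof.
move=> f_inj fE; split.
  case/andP=> K_gt0 /forallP K_conn; split.
    by have /card_gt0P[x _] := K_gt0; apply/set0Pn; exists (f x); rewrite imset_f.
  move=> X /properP[/subsetP sXV [_ /imsetP[b _ ->] fbX]] /set0Pn[y yX].
  have /imsetP[a _ Dy] := sXV y yX; rewrite {y}Dy in yX.
  case: (boolP [exists u, exists v, [&& f u \in X, f v \notin X & adj u v]]).
    case/existsP=> u /existsP[v /and3P[uX vX uv]].
    by exists (f u), (f v); rewrite -fE inE vX imset_f.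
  move=> no_edge; have cl: closed (@adj K) [pred x | f x \in X].
    apply: intro_closed; first exact/sym_connect_sym/adj_sym.
    move=> x y xy; rewrite !inE => xX; apply: contraNT no_edge => fyX.
    by apply/existsP; exists x; apply/existsP; exists y; rewrite xX fyX xy.
  have /forallP/(_ b) ab := K_conn a.
  by have := closed_connect cl ab; rewrite !inE yX (negPf fbX).
case=> /set0Pn[_ /imsetP[a _ _]] cut; apply/andP; split.
  by apply/card_gt0P; exists a.
apply/forallP=> x; apply/forallP=> y; apply: contraT => xy.
(* The component of [x] misses [y], so an edge must leave it, which is absurd. *)
pose C := f @: [set z | connect (@adj K) x z].
case: (cut C) => [||u [v []]].
- apply/properP; split; first by apply/subsetP=> _ /imsetP[z _ ->]; rewrite imset_f.
  exists (f y); first by rewrite imset_f.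
  by rewrite mem_imset // inE.
- by apply/set0Pn; exists (f x); rewrite mem_imset // inE.
case/imsetP=> u' xu ->; rewrite inE => /andP[vC /imsetP[v' _ Dv]].
rewrite Dv -fE => uv; rewrite Dv mem_imset // inE in vC.
rewrite inE in xu; case/negP: vC.
exact: connect_trans xu (connect1 uv).
Qed.

Lemma imset_valT (T : finType) (S : {set T}) :
  [set val x | x : {x : T | x \in S}] = S.
Proof.
apply/setP=> y; apply/imsetP/idP => [[x _ ->]|yS]; first exact: valP.
by exists (Sub y yS).
Qed.

Lemma connected_induced (G : sgraph) (S : {set G}) :
  connected (induced S) <-> cut_connected (@adj G) S.
Proof.
by rewrite -{2}(imset_valT S); apply: connected_cut => //; exact: val_inj.
Qed.

Lemma connected_graph_of (G : sgraph) (T : presubgraph G) :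
  connected (graph_of T) <->
  cut_connected (fun u v => (u != v) && ([set u; v] \in T.2)) T.1.
Proof.
by rewrite -(imset_valT T.1); apply: connected_cut => //; exact: val_inj.
Qed.

Lemma connected_induced_imset (K L : sgraph) (f : K -> L) (B : {set K}) :
  injective f -> {mono f : x y / adj x y} ->
  connected (induced (f @: B)) = connected (induced B).
Proof.
move=> f_inj fE; have H : connected (induced B) <->
    cut_connected (@adj L) [set f (val x) | x : induced B].
  apply: connected_cut => [x y /f_inj/val_inj //|x y]; by rewrite fE.
rewrite (imset_comp f) imset_valT in H.
by apply/idP/idP => [/connected_induced/H|/H/connected_induced].
Qed.

(** * Spanning trees and sizes of Steiner trees *)

Section SteinerTrees.
Variable G : sgraph.
Implicit Types (S W : {set G}) (T : presubgraph G).

(** Grow a vertex set [X] from a single vertex: each crossing edge brings in one new vertex and lies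
    inside the enlarged set but not inside [X], so the edges inside grow at least as fast. *)
Lemma card_connects W T : connects W T -> #|T.1| <= #|T.2|.+1.
Proof.
case/and3P=> /andP[_ /forall_inP sub_e] /connected_graph_of[/set0Pn[a aT] cut] _.
suff /(_ #|T.1|.-1): forall n, n < #|T.1| -> exists X : {set G},
    [/\ X \subset T.1, #|X| = n.+1 & n <= #|[set e in T.2 | e \subset X]|].
  have T_gt0 : 0 < #|T.1| by apply/card_gt0P; exists a.
  rewrite ltn_predL => /(_ T_gt0)[X [_ _]].
  rewrite -ltnS prednK // => le_X; apply: leq_trans le_X _.
  by rewrite ltnS; apply/subset_leq_card/subsetP=> e; rewrite inE => /andP[].
elim=> [_|n IHn lt_n]; first by exists [set a]; rewrite sub1set aT cards1.
have [X [sX cX nX]] := IHn (ltnW lt_n).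
case: (cut X) => [||u [v [uX /setDP[vT vX] /andP[_ uvT]]]].
- by rewrite properEcard sX cX.
- by rewrite -card_gt0 cX.
exists (v |: X); split; first by rewrite subUset sub1set vT.
  by rewrite cardsU1 vX cX.
apply: leq_ltn_trans nX _; apply: proper_card; apply/properP; split.
  apply/subsetP=> e; rewrite !inE => /andP[-> /= eX].
  exact: subset_trans eX (subsetUr _ _).
exists [set u; v]; rewrite !inE uvT /=.
  by rewrite subUset !sub1set !inE uX eqxx orbT.
by rewrite subUset !sub1set (negPf vX) andbF.
Qed.

Lemma connects_induced W T : connects W T -> connected (induced T.1).
Proof.
case/and3P=> /andP[/subsetP sE _] /connected_graph_of[T_n0 cut] _.
apply/connected_induced; split=> // X pX X_n0.
have [u [v [uX vX /andP[u_v uvT]]]] := cut X pX X_n0.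
exists u, v; split=> //.
have := sE _ uvT; rewrite inE => /existsP[x /existsP[y /andP[xy /eqP E]]].
have: u \in [set x; y] by rewrite -E set21.
have: v \in [set x; y] by rewrite -E set22.
rewrite !inE => /orP[] /eqP Dv /orP[] /eqP Du; subst u v => //.
- by rewrite eqxx in u_v.
- by rewrite adj_sym.
- by rewrite eqxx in u_v.
Qed.

(** The new edge crosses any cut that contains [V] or misses [V]; every other cut also splits [V]
    and is crossed by an old edge. *)
Lemma cut_connected_add_leaf (V : {set G}) (E : {set {set G}}) u v :
  u \in V -> v \notin V ->
  cut_connected (fun x y => (x != y) && ([set x; y] \in E)) V ->
  cut_connected (fun x y => (x != y) && ([set x; y] \in [set u; v] |: E))
    (v |: V).
Proof.
move=> uV vV [_ cut]; have u_v : u != v by apply: contraNneq vV => <-.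
split; first by apply/set0Pn; exists v; rewrite setU11.
move=> X pX X_n0; have [sX [w wvV wX]] := properP pX.
case: (boolP (V \subset X)) => [sVX|nVX].
  have wE : w = v.
    by move: wvV; rewrite !inE => /orP[/eqP//|/(subsetP sVX)]; rewrite (negPf wX).
  rewrite wE in wX; exists u, v; split; last by rewrite u_v setU11.
    exact: (subsetP sVX).
  by rewrite inE wX setU11.
case: (eqVneq (X :&: V) set0) => [XV0|XV_n0].
  have XE x : x \in X -> x = v.
    move=> xX; have := subsetP sX x xX; rewrite !inE => /orP[/eqP//|xV].
    by have := in_set0 x; rewrite -XV0 inE xX xV.
  have [x xX] := set0Pn _ X_n0; have Dx := XE x xX; rewrite Dx in xX.
  exists v, u; split=> //; last by rewrite eq_sym u_v setUC setU11.
  rewrite !inE uV orbT andbT; apply/negP=> /XE E1; by rewrite E1 eqxx in u_v.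
case: (cut (X :&: V)) => // [|x [y [/setIP[xX xV] /setDP[yV yX] /andP[xy xyE]]]].
  rewrite properE subsetIr; apply: contra nVX => sV.
  exact: subset_trans sV (subsetIl _ _).
exists x, y; split=> //; last by rewrite xy inE xyE orbT.
by move: yX; rewrite !inE yV !(andbT, orbT).
Qed.

(** Leaves are attached one at a time along crossing edges, so [n] edges always go with [n.+1]
    vertices. *)
Lemma spanning_tree S : connected (induced S) ->
  exists T, [/\ connects S T, T.1 = S & #|T.2|.+1 = #|S|].
Proof.
case/connected_induced=> /set0Pn[a aS] cut.
suff /(_ #|S|.-1): forall n, n < #|S| -> exists T,
    [/\ T.1 \subset S, #|T.1| = n.+1, #|T.2| = n & connects T.1 T].
  have S_gt0 : 0 < #|S| by apply/card_gt0P; exists a.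
  rewrite ltn_predL => /(_ S_gt0)[T [sT cT cT2 conT]].
  rewrite prednK // in cT; have TE : T.1 = S.
    by apply/eqP; rewrite eqEcard sT cT leqnn.
  by rewrite TE in conT; exists T; rewrite cT2 prednK.
elim=> [_|n IHn lt_n].
  exists ([set a], set0); rewrite /= sub1set aS cards1 cards0; split=> //.
  rewrite /connects /is_subgraph /= sub0set subxx andbT; apply/andP; split.
    by apply/forall_inP=> e; rewrite inE.
  apply/connected_graph_of; split=> /=; first by rewrite -card_gt0 cards1.
  by move=> X /proper_card; rewrite cards1 ltnS leqn0 cards_eq0 => ->.
have [[V E] /= [sV cV cE]] := IHn (ltnW lt_n).
rewrite /connects /is_subgraph /= subxx andbT => /andP[/andP[sE /forall_inP subE]].
move/connected_graph_of => /= conV.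
case: (cut V) => [||u [v [uV /setDP[vS vV] uv]]].
- by rewrite properEcard sV cV.
- by rewrite -card_gt0 cV.
exists (v |: V, [set u; v] |: E); split=> /=.
- by rewrite subUset sub1set vS.
- by rewrite cardsU1 vV cV.
(* Old edges lie inside [V] and [v] does not, so the edge is new and the count stays exact. *)
- rewrite cardsU1 cE; suff -> : [set u; v] \notin E by [].
  by apply: contra vV => /subE; rewrite subUset !sub1set => /andP[].
rewrite /connects /is_subgraph /= subxx andbT; apply/andP; split; last first.
  exact/connected_graph_of/cut_connected_add_leaf.
apply/andP; split.
  rewrite subUset sE andbT sub1set inE.
  by apply/existsP; exists u; apply/existsP; exists v; rewrite uv eqxx.
apply/forall_inP=> e; rewrite inE => /orP[/set1P ->|/subE eV].
  by rewrite subUset !sub1set !inE uV eqxx orbT.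
exact: subset_trans eV (subsetUr _ _).
Qed.

Lemma connects_extension W S T :
  W \subset S -> T.1 = S -> connects S T -> connects W T.
Proof.
by move=> sWS TS /and3P[sT cT _]; rewrite /connects sT cT TS sWS.
Qed.

(** A spanning tree of [W] caps the edges of [T] at one less than the size of [W], which leaves no
    room for further vertices. *)
Lemma steiner_tree_connected W T :
  connected (induced W) -> steiner_tree W T -> T.1 = W.
Proof.
case/spanning_tree=> T0 [cT0 _ cardT0] /andP[cT /forallP/(_ T0)].
rewrite cT0 /= => minT; have sWT : W \subset T.1 by case/and3P: cT.
apply/esym/eqP; rewrite eqEcard sWT -cardT0.
exact: leq_trans (card_connects cT) _.
Qed.

Lemma leq_card_connects W T :
  ~~ connected (induced W) -> connects W T -> #|W| <= #|T.2|.
Proof.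
move=> nW cT; rewrite -ltnS; apply: leq_trans (card_connects cT).
have sWT : W \subset T.1 by case/and3P: cT.
apply: proper_card; rewrite properEneq sWT andbT.
by apply: contraNneq nW => ->; exact: connects_induced cT.
Qed.

(** A spanning tree of the extension has exactly as many edges as [W] has vertices, and this meets
    the bound of [leq_card_connects]. *)
Lemma extension_steiner_tree W v :
  ~~ connected (induced W) -> v \notin W -> connected (induced (v |: W)) ->
  exists T, [/\ steiner_tree W T, T.1 = v |: W & #|T.2| = #|W|].
Proof.
move=> nW vW /spanning_tree[T [cT TE cardT]].
move: cardT; rewrite cardsU1 vW add1n => -[cardT].
exists T; split=> //; rewrite /steiner_tree (connects_extension _ TE cT) ?subsetUr //.
by apply/forallP=> T'; apply/implyP; rewrite cardT; exact: leq_card_connects.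
Qed.

Lemma one_point_connects W T v :
  connects W T -> #|T.2| <= #|W| -> v \in T.1 -> v \notin W -> T.1 = v |: W.
Proof.
move=> cT leT vT vW; have sWT : W \subset T.1 by case/and3P: cT.
apply/esym/eqP; rewrite eqEcard subUset sub1set vT sWT cardsU1 vW add1n.
exact: leq_trans (card_connects cT) _.
Qed.

Lemma steiner_dist_card W :
  steiner_dist W = Some #|W| <->
  ~~ connected (induced W) /\
  (exists2 v, v \notin W & connected (induced (v |: W))).
Proof.
split=> [/steiner_dist_Some[[T cT cardT] minT]|[nW [v vW cvW]]]; last first.
  have [T [/andP[cT _] _ cardT]] := extension_steiner_tree nW vW cvW.
  by apply/steiner_dist_Some; split; [exists T | move=> T'; exact: leq_card_connects].
have nW : ~~ connected (induced W).
  apply/negP=> /spanning_tree[T0 [cT0 _ cardT0]].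
  by have := minT _ cT0; rewrite -cardT0 ltnn.
split=> //; have sWT : W \subset T.1 by case/and3P: cT.
have /properP[_ [v vT vW]] : W \proper T.1.
  rewrite properEneq sWT andbT.
  by apply: contraNneq nW => ->; exact: connects_induced cT.
exists v => //; rewrite -(one_point_connects cT _ vT vW) ?cardT //.
exact: connects_induced cT.
Qed.

End SteinerTrees.

(** * Join-criticality in terms of connectivity alone *)

Definition unfillable (k : nat) (G : sgraph) (A : {set G}) : Prop :=
  forall (B : {set G}) v, B \subset A -> #|B| = k -> ~~ connected (induced B) ->
    v \in A -> v \notin B -> ~~ connected (induced (v |: B)).

Section Unfillable.
Variable k : nat.

Lemma steiner_clique_unfillable (G : sgraph) (A : {set G}) :
  steiner_clique k A -> unfillable k A.
Proof.
move=> /forallP cA B v sBA cB /negP[].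
by apply: (implyP (cA B)); rewrite sBA cB eqxx.
Qed.

(** Serves to pass between a side of the join and the join itself: subsets of the image are images
    of subsets, and [f] preserves their connectivity. *)
Lemma unfillable_imset (K L : sgraph) (f : K -> L) (A : {set K}) :
  injective f -> {mono f : x y / adj x y} ->
  unfillable k (f @: A) <-> unfillable k A.
Proof.
move=> f_inj fE; have conE (B : {set K}) := connected_induced_imset B f_inj fE.
split=> unA B v sBA cB.
  rewrite -conE -(mem_imset A v f_inj) -(mem_imset B v f_inj) => nB vA vB.
  by rewrite -conE imsetU1; apply: unA; rewrite ?imsetS ?card_imset.
have BE : B = f @: (f @^-1: B).
  apply/setP=> y; apply/idP/imsetP => [yB|[x]]; last by rewrite inE => ? ->.
  by have /imsetP[x _ Dy] := subsetP sBA y yB; exists x; rewrite // inE -Dy.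
move: cB; rewrite BE conE card_imset // => cB nB /imsetP[x xA ->].
rewrite mem_imset // => xB; rewrite -imsetU1 conE.
apply: unA => //; apply/subsetP=> y; rewrite inE => /(subsetP sBA).
by rewrite mem_imset.
Qed.

(** Inside [induced A] only vertices of [A] are available as extensions, so [steiner_dist_card]
    applied there and read back along [val] gives the condition. *)
Lemma steiner_join_criticalP (G : sgraph) (A : {set G}) :
  steiner_join_critical k A <-> k <= #|A| /\ unfillable k A.
Proof.
have val_inj' : injective (val : induced A -> G) by exact: val_inj.
have valE : {mono (val : induced A -> G) : x y / adj x y} by [].
have conE (C : {set induced A}) := connected_induced_imset C val_inj' valE.
have imE (B : {set G}) : B \subset A ->
    [set val x | x in [set x : induced A | val x \in B]] = B.
  move=> sBA; apply/setP=> y; apply/imsetP/idP => [[x xB ->]|yB].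
    by rewrite inE in xB.
  by exists (Sub y (subsetP sBA y yB)); rewrite ?inE.
have cardE (B : {set G}) : B \subset A ->
    #|[set x : induced A | val x \in B]| = #|B|.
  by move=> sBA; rewrite -{2}(imE B sBA) card_imset.
split.
  case/andP=> kA /forallP crA; split=> // B v sBA cB nB vA vB.
  have := implyP (crA B); rewrite sBA cB eqxx => /(_ isT)/eqP dB.
  apply/negP=> cvB; case: dB; rewrite -cB -(cardE B sBA).
  apply/steiner_dist_card; split; first by rewrite -conE imE.
  exists (Sub v vA : induced A); first by rewrite inE.
  by rewrite -conE imsetU1 imE.
case=> kA unA; rewrite /steiner_join_critical kA /=.
apply/forallP=> B; apply/implyP=> /andP[sBA /eqP cB]; apply/eqP.
rewrite -cB -(cardE B sBA) => /steiner_dist_card[].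
rewrite -conE imE // => nB [v]; rewrite inE => vB.
rewrite -conE imsetU1 imE //; apply/negP; apply: unA => //; exact: valP.
Qed.

Lemma leq_card_sjc (G : sgraph) (A : {set G}) :
  k <= #|A| -> unfillable k A -> #|A| <= sjc k G.
Proof.
move=> kA unA; rewrite /sjc; case: ifP => _; first exact: max_card.
have critA : steiner_join_critical k A by apply/steiner_join_criticalP.
exact: leq_bigmax_cond critA.
Qed.

Lemma sjc_witness (G : sgraph) :
  exists2 A : {set G}, #|A| = sjc k G & unfillable k A.
Proof.
rewrite /sjc; case: ifP => [leGk|_].
  (* When [k] is at least the order of [G], a set of size [k] can only be the whole vertex set,
     which leaves no vertex to add. *)
  exists [set: G]; first exact: cardsT.
  move=> B v _ cB _ _; suff -> : B = setT by rewrite inE.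
  by apply/eqP; rewrite eqEcard subsetT cardsT cB.
case: (boolP [exists A : {set G}, steiner_join_critical k A]) => [/existsP[A0 A0c]|].
  rewrite (bigmax_eq_arg A0) //; case: arg_maxnP => // A /steiner_join_criticalP[_ unA] _.
  by exists A.
(* Without critical sets the maximum is the default 0, realised by the empty set. *)
rewrite negb_exists => /forallP noA; rewrite big_pred0; last first.
  by move=> A; exact/negbTE/noA.
exists set0; first by rewrite cards0.
by move=> B v _ _ _; rewrite inE.
Qed.

End Unfillable.

(** * Connectivity and general position in joins *)

Section Join.
Variables G H : sgraph.
Local Notation J := (join G H).

(** Take [u] inside and [v] outside the cut. On opposite sides they are adjacent; on the same side,
    [a] or [b] from the other side is adjacent to both, and one of these two edges crosses. *)
Lemma join_connected (S : {set J}) (a : G) (b : H) :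
  inl a \in S -> inr b \in S -> connected (induced S).
Proof.
move=> aS bS; apply/connected_induced; split; first by apply/set0Pn; exists (inl a).
move=> X /properP[_ [v vS vX]] /set0Pn[u uX].
have vSX : v \in S :\: X by rewrite inE vX.
case: u v uX vX vS vSX => u [] v uX vX vS vSX.
- case: (boolP ((inr b : J) \in X)) => bX; first by exists (inr b), (inl v).
  by exists (inl u), (inr b); rewrite inE bX.
- by exists (inl u), (inr v).
- by exists (inr u), (inl v).
- case: (boolP ((inl a : J) \in X)) => aX; first by exists (inl a), (inr v).
  by exists (inr u), (inl a); rewrite inE aX.
Qed.

(** The vertex is chosen on the side opposite to some member of [B]; it may already belong to [B],
    in which case [B] itself is connected. *)
Lemma join_extension (B : {set J}) : 0 < #|G| -> 0 < #|H| -> 0 < #|B| ->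
  exists v, connected (induced (v |: B)).
Proof.
case/card_gt0P=> a _ /card_gt0P[b _] /card_gt0P[[x|y] B_in].
  by exists (inr b); apply: (@join_connected _ x b); rewrite !inE ?B_in ?eqxx ?orbT.
by exists (inl a); apply: (@join_connected _ a y); rewrite !inE ?B_in ?eqxx ?orbT.
Qed.

Lemma join_general_position k (A : {set J}) : 0 < #|G| -> 0 < #|H| -> 0 < k ->
  steiner_general_position k A <-> unfillable k A.
Proof.
move=> G_gt0 H_gt0 k_gt0; split.
  move=> /forallP gpA B v sBA cB nB vA vB; apply/negP=> cvB.
  have [T [stT TE _]] := extension_steiner_tree nB vB cvB.
  have := implyP (gpA B); rewrite sBA cB eqxx => /(_ isT)/forallP/(_ T).
  rewrite stT TE => /eqP E; case/negP: vB.
  by rewrite -E !inE eqxx vA.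
move=> unA; apply/forallP=> B; apply/implyP=> /andP[sBA /eqP cB].
apply/forallP=> T; apply/implyP=> stT.
case: (boolP (connected (induced B))) => [conB|nB].
  by rewrite (steiner_tree_connected conB stT); apply/eqP/setIidPl.
have /andP[cT /forallP minT] := stT.
have sBT : B \subset T.1 by case/and3P: cT.
rewrite eqEsubset subsetI sBT sBA !andbT.
apply/subsetP=> v /setIP[vT vA]; apply: contraT => vB.
(* Minimality against a one-point extension, which always exists in a join; hence [T] has at most
   one vertex outside [B]. *)
have leT : #|T.2| <= #|B|.
  have [|w cwB] := @join_extension B G_gt0 H_gt0; first by rewrite cB.
  have wB : w \notin B.
    by apply: contra nB => wB; rewrite (setUidPr _) ?sub1set // in cwB.
  have [T0 [/andP[cT0 _] _ <-]] := extension_steiner_tree nB wB cwB.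
  exact: implyP (minT T0) cT0.
case/negP: (unA B v sBA cB nB vA vB).
rewrite -(one_point_connects cT leT vT vB); exact: connects_induced cT.
Qed.

End Join.

(** * The formula for joins *)

Lemma leq_card_sjc_embedded k (K L : sgraph) (f : K -> L) (A : {set L}) :
  injective f -> {mono f : x y / adj x y} -> A \subset f @: setT ->
  k <= #|A| -> unfillable k A -> #|A| <= sjc k K.
Proof.
move=> f_inj fE sA; have -> : A = f @: (f @^-1: A).
  apply/setP=> y; apply/idP/imsetP => [yA|[x]]; last by rewrite inE => ? ->.
  by have /imsetP[x _ Dy] := subsetP sA y yA; exists x; rewrite // inE -Dy.
rewrite card_imset // => kA /(unfillable_imset _ _ f_inj fE).
exact: leq_card_sjc.
Qed.

Theorem theorem4p2 (G H : sgraph) (k : nat)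
    (hG : 0 < #|G|) (hH : 0 < #|H|)
    (hk : 2 <= k <= #|join G H| - 1) :
  sgp k (join G H) =
  maxn (somega k (join G H)) (maxn (sjc k G) (sjc k H)).
Proof.
have k_gt0 : 0 < k by case/andP: hk => /ltnW.
have inlI : injective (inl : G -> join G H) by move=> x y [].
have inrI : injective (inr : H -> join G H) by move=> x y [].
have inlE : {mono (inl : G -> join G H) : x y / adj x y} by [].
have inrE : {mono (inr : H -> join G H) : x y / adj x y} by [].
have leq_sgp (A : {set join G H}) : unfillable k A -> #|A| <= sgp k (join G H).
  move/join_general_position => /(_ hG hH k_gt0) gpA.
  exact: leq_bigmax_cond gpA.
(* Lower bound first: an optimal set for each of the three quantities is unfillable in the join. *)
apply/eqP; rewrite eqn_leq; apply/andP; split; last first.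
  rewrite !geq_max; apply/and3P; split.
  - by apply/bigmax_leqP=> A /steiner_clique_unfillable/leq_sgp.
  - have [A <- unA] := sjc_witness k G; rewrite -(card_imset _ inlI).
    exact/leq_sgp/unfillable_imset.
  - have [A <- unA] := sjc_witness k H; rewrite -(card_imset _ inrI).
    exact/leq_sgp/unfillable_imset.
apply/bigmax_leqP=> A /join_general_position => /(_ hG hH k_gt0) unA.
case: (boolP (steiner_clique k A)) => [clA|].
  by rewrite leq_max (leq_bigmax_cond _ clA).
rewrite negb_forall => /existsP[B]; rewrite negb_imply => /andP[/andP[sBA /eqP cB] nB].
have kA : k <= #|A| by rewrite -cB subset_leq_card.
(* [B] is a disconnected [k]-subset of [A]. A vertex of [A] on the side opposite to [b] would make
   [B] connected, either as a member or as an added vertex; both are excluded, so [A] lies on the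
   side of [b]. *)
have /card_gt0P[[b|b] bB] : 0 < #|B| by rewrite cB.
  rewrite !leq_max (leq_card_sjc_embedded inlI inlE _ kA unA) ?orbT //.
  apply/subsetP=> -[x|x] xA; first by rewrite imset_f.
  have con : connected (@induced (join G H) (inr x |: B)).
    by apply: (@join_connected _ _ _ b x); rewrite !inE ?bB ?eqxx ?orbT.
  case: (boolP (inr x \in B)) => xB; last by rewrite (negPf (unA B _ _ _ _ _ _)) in con.
  by case/negP: nB; apply: join_connected bB xB.
rewrite !leq_max (leq_card_sjc_embedded inrI inrE _ kA unA) ?orbT //.
apply/subsetP=> -[x|x] xA; last by rewrite imset_f.
have con : connected (@induced (join G H) (inl x |: B)).
  by apply: (@join_connected _ _ _ x b); rewrite !inE ?bB ?eqxx ?orbT.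
case: (boolP (inl x \in B)) => xB; last by rewrite (negPf (unA B _ _ _ _ _ _)) in con.
by case/negP: nB; apply: join_connected xB bB.
Qed.
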